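(* Let $p>1$ be real and $n$ a positive integer. Define a random sequence $n=\lambda_0'\ge\lambda_1'\ge\lambda_2'\ge\cdots$ of nonnegative integers by the rule: if $\lambda_l'=a$, then $\lambda_{l+1}'=b$ (for $0\le b\le a$) with probability \[ K(a,b)=\frac{\prod_{i=1}^a(1-1/p^i)}{p^{\binom{b+1}{2}}\prod_{i=1}^b(1-1/p^i)\prod_{j=1}^{\lfloor(a-b)/2\rfloor}(1-1/p^{2j})}. \] Then the partition $\lambda$ with column lengths $\lambda_1',\lambda_2',\ldots$ (which has at most $n$ parts) is distributed according to \[ P^{\mathrm{Sym}}_n(\lambda)=\frac{\prod_{j=n-r+1}^n(1-1/p^j)\prod_{i=1}^{\lceil(n-r)/2\rceil}(1-1/p^{2i-1})}{p^{n(\lambda)+|\lambda|}\prod_{i\ge1}\prod_{j=1}^{\lfloor m_i(\lambda)/2\rfloor}(1-1/p^{2j})}, \] where $r$ is the number of parts of $\lambda$.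
   Context: For a partition $\lambda$: $|\lambda|=\sum\lambda_i$, $m_i(\lambda)$ is the number of parts equal to $i$, $\lambda_i'$ is the $i$-th column length of its diagram, $r=\lambda_1'$ its number of parts, and $n(\lambda)=\sum_i\binom{\lambda_i'}{2}$. *)

(* Defs.v *)
From HB Require Import structures.
From mathcomp Require Export all_boot all_order all_algebra.
From mathcomp Require Export all_classical all_reals all_analysis.

Set Implicit Arguments.
Unset Strict Implicit.
Unset Printing Implicit Defensive.

Import Order.TTheory GRing.Theory Num.Theory.

Local Open Scope classical_set_scope.
Local Open Scope ring_scope.

(* A partition is the sequence of its (positive) parts in weakly decreasing
   order; its number of parts is [size la], its size |la| is [sumn la]. *)
Definition is_partition (la : seq nat) : bool :=
  sorted geq la && (0%N \notin la).

(* Columns are numbered from 1; [part_col la i] is the number of rows of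
   length at least i. *)
Definition part_col (la : seq nat) (i : nat) : nat := count (leq i) la.

Definition part_mult (la : seq nat) (i : nat) : nat := count_mem i la.

(* Columns beyond the largest part [head 0 la] are empty, so the sum over all
   i >= 1 stops there; likewise for the product over i in [Psym]. *)
Definition part_n (la : seq nat) : nat :=
  (\sum_(1 <= i < (head 0 la).+1) 'C(part_col la i, 2))%N.

Definition Ksym (R : realType) (p : R) (a b : nat) : R :=
  if (b <= a)%N then
    (\prod_(1 <= i < a.+1) (1 - 1 / p ^+ i)) /
    (p ^+ 'C(b.+1, 2) * (\prod_(1 <= i < b.+1) (1 - 1 / p ^+ i)) *
     \prod_(1 <= j < ((a - b)./2).+1) (1 - 1 / p ^+ (2 * j)))
  else 0.

(* Meaningful for [size la <= n] only, because of the truncated [n - size la];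
   [uphalf] is the ceiling of the half. *)
Definition Psym (R : realType) (p : R) (n : nat) (la : seq nat) : R :=
  let r := size la in
  ((\prod_((n - r).+1 <= j < n.+1) (1 - 1 / p ^+ j)) *
   \prod_(1 <= i < (uphalf (n - r)).+1) (1 - 1 / p ^+ (2 * i - 1))) /
  (p ^+ (part_n la + sumn la) *
   \prod_(1 <= i < (head 0%N la).+1)
     \prod_(1 <= j < ((part_mult la i)./2).+1) (1 - 1 / p ^+ (2 * j))).

Definition stochastic_kernel (R : realType) (K : nat -> nat -> R) : Prop :=
  forall a, (forall b, 0 <= K a b) /\ \sum_(0 <= b < a.+1) K a b = 1 /\
            (forall b, (a < b)%N -> K a b = 0).

(* The second clause says that, conditionally on any history
   X_0 = a 0, ..., X_l = a l of positive probability, X_(l+1) = a (l+1) has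
   probability K (a l) (a (l+1)); it is multiplied out so that it needs no
   conditional probability. *)
Definition markov_chain_from (d : measure_display) (T : measurableType d)
    (R : realType) (P : probability T R) (K : nat -> nat -> R) (n : nat)
    (X : nat -> {RV P >-> nat}) : Prop :=
  P [set w | X 0%N w = n] = 1%E /\
  forall (l : nat) (a : nat -> nat),
    P [set w | forall i, (i <= l.+1)%N -> X i w = a i] =
    (P [set w | forall i, (i <= l)%N -> X i w = a i] *
     (K (a l) (a l.+1))%:E)%E.

(* The sequence x_1, x_2, ... lists the column lengths of [la]; x_0 is not a
   column. *)
Definition has_columns (la : seq nat) (x : nat -> nat) : Prop :=
  forall i, (1 <= i)%N -> x i = part_col la i.

(* Main.v *)
(** Writing q = 1/p, the rows of K sum to 1 because the generating functions
    of the two factors of K(a, b) depending on b and on a - b multiply to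
    (-xq; q)_oo * (1 + x) / (x^2; q^2)_oo = 1 / (x; q)_oo; coefficientwise this
    is the recurrence (1 - q^a) c_a = c_(a-1) of their convolution.  Along a
    path n, la'_1, la'_2, ... the factors (q)_a telescope, which yields the
    formula for the law.  Finally, K(a, b) = 0 for b > a forces the path to be
    nonincreasing, and K(c, c) < 1 for c > 0 prevents it from staying constant
    at a positive value, so almost surely it lists the columns of a
    partition. *)

Require Import Defs.
From mathcomp Require Import ring zify.

Set Implicit Arguments.
Unset Strict Implicit.
Unset Printing Implicit Defensive.

Import Order.TTheory GRing.Theory Num.Theory.

Local Open Scope classical_set_scope.
Local Open Scope ring_scope.

(** * Coefficient sequences of power series *)

Section Convolution.
Variable R : comPzRingType.
Implicit Types f g : nat -> R.

(** The Cauchy product: coefficients of the product of two generating functions. *)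
Definition conv f g (a : nat) : R := \sum_(i < a.+1) f i * g (a - i)%N.

(** Multiplication of the generating function by x. *)
Definition shift f (n : nat) : R := if n is n'.+1 then f n' else 0.

Lemma conv_shiftl f g a : conv (shift f) g a = shift (conv f g) a.
Proof.
rewrite /conv; case: a => [|a]; first by rewrite big_ord1 mul0r.
rewrite big_ord_recl mul0r add0r; apply: eq_bigr => i _.
by rewrite subSS.
Qed.

Lemma conv_shiftr f g a : conv f (shift g) a = shift (conv f g) a.
Proof.
rewrite /conv; case: a => [|a]; first by rewrite big_ord1 mulr0.
rewrite big_ord_recr /= subnn mulr0 addr0; apply: eq_bigr => i _.
by rewrite subSn// -ltnS.
Qed.

End Convolution.

(** * Finite q-products, with q = 1/p, and the row sums of the kernel *)

Section Kernel.
Variables (R : realType) (p : R).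

Definition qpoch (a : nat) : R := \prod_(1 <= i < a.+1) (1 - 1 / p ^+ i).

Definition qpoch_even (m : nat) : R :=
  \prod_(1 <= j < m.+1) (1 - 1 / p ^+ (2 * j)).

Definition qpoch_odd (m : nat) : R :=
  \prod_(1 <= i < m.+1) (1 - 1 / p ^+ (2 * i - 1)).

Lemma qpochS a : qpoch a.+1 = qpoch a * (1 - 1 / p ^+ a.+1).
Proof. by rewrite /qpoch big_nat_recr. Qed.

Lemma qpoch_evenS m :
  qpoch_even m.+1 = qpoch_even m * (1 - 1 / p ^+ (2 * m.+1)).
Proof. by rewrite /qpoch_even big_nat_recr. Qed.

Lemma qpoch_oddS m :
  qpoch_odd m.+1 = qpoch_odd m * (1 - 1 / p ^+ (2 * m).+1).
Proof.
rewrite /qpoch_odd big_nat_recr//=; congr (_ * (1 - 1 / p ^+ _)); lia.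
Qed.

Lemma qpoch0 : qpoch 0 = 1. Proof. by rewrite /qpoch big_geq. Qed.
Lemma qpoch_even0 : qpoch_even 0 = 1.
Proof. by rewrite /qpoch_even big_geq. Qed.
Lemma qpoch_odd0 : qpoch_odd 0 = 1.
Proof. by rewrite /qpoch_odd big_geq. Qed.

(** Sorts the factors by the parity of their exponent. The even ones will cancel against the first
    transition, which leaves the odd product of [Psym]. *)
Lemma qpoch_parity_split a : qpoch a = qpoch_even a./2 * qpoch_odd (uphalf a).
Proof.
elim: a => [|a IH]; first by rewrite qpoch0 qpoch_even0 qpoch_odd0 mulr1.
rewrite qpochS IH [uphalf a.+1]/= uphalf_half -[a in p ^+ a.+1]odd_double_half.
have -> : a.+1./2 = (odd a + a./2)%N by rewrite -uphalf_half.
case: (odd a); rewrite ?add0n ?add1n.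
  by rewrite qpoch_evenS -!muln2 [(2 * _)%N]mulnC mulSn -mulrA mulrAC -!mulrA;
     congr (_ * _); rewrite mulrC.
by rewrite qpoch_oddS -muln2 [(2 * _)%N]mulnC mulrA.
Qed.

Lemma KsymE a b : (b <= a)%N -> Ksym p a b =
  qpoch a / (p ^+ 'C(b.+1, 2) * qpoch b * qpoch_even (a - b)./2).
Proof. by rewrite /Ksym => ->. Qed.

Hypothesis hp : 1 < p.

Lemma qfactor_gt0 i : (0 < i)%N -> 0 < 1 - 1 / p ^+ i.
Proof.
move=> i0; rewrite subr_gt0 div1r invf_lt1 ?exprn_gt0 ?(lt_trans ltr01)//.
by rewrite exprn_egt1// -lt0n.
Qed.

Lemma qpoch_gt0 a : 0 < qpoch a.
Proof.
elim: a => [|a IH]; first by rewrite qpoch0.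
by rewrite qpochS mulr_gt0// qfactor_gt0.
Qed.

Lemma qpoch_even_gt0 m : 0 < qpoch_even m.
Proof.
elim: m => [|m IH]; first by rewrite qpoch_even0.
by rewrite qpoch_evenS mulr_gt0// qfactor_gt0.
Qed.

Lemma Ksym_ge0 a b : 0 <= Ksym p a b.
Proof.
have [ba|ab] := leqP b a; last by rewrite /Ksym leqNgt ab.
rewrite KsymE//; apply: ltW; rewrite divr_gt0 ?qpoch_gt0//.
by rewrite !mulr_gt0 ?qpoch_gt0 ?qpoch_even_gt0 ?exprn_gt0 ?(lt_trans ltr01).
Qed.

Lemma Ksym_diag c : Ksym p c c = (p ^+ 'C(c.+1, 2))^-1.
Proof.
rewrite KsymE// subnn qpoch_even0 mulr1 invfM mulrCA mulfV ?mulr1//.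
by rewrite gt_eqF// qpoch_gt0.
Qed.

(** [A], [B], [D] are the coefficients of A(x) = (-xq; q)_oo, B(x) = (1 + x) / (x^2; q^2)_oo and
    A(qx). For b <= a, K(a, b) is (q)_a A_b B_(a-b). *)
Let A b := (p ^+ 'C(b.+1, 2) * qpoch b)^-1.
Let B m := (qpoch_even m./2)^-1.
Let D b := (p ^+ b)^-1 * A b.

Let p_neq0 : p != 0. Proof. by rewrite gt_eqF// (lt_trans ltr01). Qed.

(** Coefficient form of A(x) = (1 + qx) A(qx), which splits off the first factor of the infinite
    product. *)
Let A_rec b : A b = D b + p^-1 * shift D b.
Proof.
case: b => [|b]; first by rewrite /shift /D expr0 invr1 mul1r mulr0 addr0.
have pS : p ^+ 'C(b.+2, 2) = p ^+ 'C(b.+1, 2) * (p * p ^+ b).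
  by rewrite binS bin1 exprD exprS.
rewrite /shift /D /A qpochS pS exprS.
have := qfactor_gt0 (ltn0Sn b); rewrite exprS => /lt0r_neq0.
have := lt0r_neq0 (qpoch_gt0 b).
have : p ^+ b != 0 by rewrite expf_neq0.
have : p ^+ 'C(b.+1, 2) != 0 by rewrite expf_neq0.
move: (p ^+ 'C(b.+1, 2)) (p ^+ b) (qpoch b) => x y z x0 y0 z0 h.
(* [field] turns 1 - 1/p^(b+1) into p^(b+1) - 1 over a power of p; [y] stands for p^b. *)
have h' : p * y - 1 != 0.
  apply: contra_neq h => /eqP; rewrite subr_eq0 => /eqP ->.
  by rewrite divr1 subrr.
by field; rewrite ?x0 ?y0 ?z0 ?h' ?p_neq0.
Qed.

(** Coefficient form of B(qx) = (1 - x)(1 + qx) B(x): passing to qx removes 1 - x^2 from the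
    denominator and turns 1 + x into 1 + qx. *)
Let B_rec m : (p ^+ m)^-1 * B m =
  B m + (p^-1 - 1) * shift B m - p^-1 * shift (shift B) m.
Proof.
rewrite /B; case: m => [|[|m]] /=.
- by rewrite expr0 invr1 mulr0 mulr0 subr0 addr0 mul1r.
- by rewrite expr1 qpoch_even0 invr1; ring.
(* With m = [odd m] + 2k, each parity becomes a rational identity in p, p^(2k) and
   [qpoch_even k]. *)
rewrite uphalf_half -[m in p ^+ m.+2]odd_double_half; move: (m./2) => k.
have pE : p ^+ (2 * k.+1) = p * (p * p ^+ k.*2).
  by rewrite -!exprS; congr (_ ^+ _); lia.
have y0 := lt0r_neq0 (qpoch_even_gt0 k).
have h := lt0r_neq0 (qfactor_gt0 (ltn0Sn (2 * k).+1)).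
have {h} : p * (p * p ^+ k.*2) - 1 != 0.
  apply: contra_neq h => /eqP; rewrite subr_eq0 => /eqP e.
  by rewrite (_ : (2 * k).+2 = 2 * k.+1)%N ?pE ?e ?divr1 ?subrr//; lia.
have : p ^+ k.*2 != 0 by rewrite expf_neq0.
case: (odd m) => /=; rewrite ?add0n ?add1n qpoch_evenS pE.
- rewrite (_ : p ^+ (k.*2).+3 = p * (p * (p * p ^+ k.*2))) ?exprS//.
  move: (p ^+ k.*2) (qpoch_even k) y0 => x y y0 x0 h.
  by field; rewrite ?x0 ?y0 ?h ?p_neq0.
- rewrite (_ : p ^+ (k.*2).+2 = p * (p * p ^+ k.*2)) ?exprS//.
  move: (p ^+ k.*2) (qpoch_even k) y0 => x y y0 x0 h.
  by field; rewrite ?x0 ?y0 ?h ?p_neq0.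
Qed.

(** The factor 1 + qx of B(qx) turns A(qx) back into A(x), so A(qx)B(qx) = (1 - x)A(x)B(x). *)
Let conv_AB_rec a : (p ^+ a)^-1 * conv A B a = conv A B a - shift (conv A B) a.
Proof.
pose E := conv D B.
have ABE m : conv A B m = E m + p^-1 * shift E m.
  rewrite -conv_shiftl /E /conv mulr_sumr -big_split; apply: eq_bigr => i _ /=.
  by rewrite {1}A_rec; ring.
have -> : (p ^+ a)^-1 * conv A B a =
    E a + (p^-1 - 1) * shift E a - p^-1 * shift (shift E) a.
  have -> : shift (shift E) a = conv D (shift (shift B)) a.
    by rewrite conv_shiftr; case: a => //= a; rewrite conv_shiftr.
  rewrite -conv_shiftr /E /conv !mulr_sumr -sumrN -!big_split.
  apply: eq_bigr => i _ /=.
  transitivity (D i * ((p ^+ (a - i))^-1 * B (a - i))).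
    rewrite /D -[in p ^+ a](subnKC (ltn_ord i : (i <= a)%N)) exprD invfM; ring.
  by rewrite B_rec; ring.
by rewrite ABE; case: a => [|a] /=; rewrite ?ABE; ring.
Qed.

Let conv_AB a : conv A B a = (qpoch a)^-1.
Proof.
elim: a => [|a IH].
  rewrite /conv big_ord1 /A /B qpoch_even0 qpoch0 bin_small// expr0.
  by rewrite !(mulr1, invr1).
have /= := conv_AB_rec a.+1; rewrite IH => h.
have q0 := lt0r_neq0 (qfactor_gt0 (ltn0Sn a)).
rewrite qpochS invfM; apply: (mulIf q0); rewrite mulfVK//.
by rewrite mulrBr mulr1 div1r [_ * _^-1]mulrC h subKr.
Qed.

Lemma Ksym_stochastic : stochastic_kernel (Ksym p).
Proof.
move=> a; split; first exact: Ksym_ge0.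
split; last by move=> b ab; rewrite /Ksym leqNgt ab.
rewrite big_mkord -[RHS](mulfV (lt0r_neq0 (qpoch_gt0 a))) -conv_AB.
rewrite /conv mulr_sumr.
apply: eq_bigr => i _; rewrite KsymE; last by rewrite -ltnS.
by rewrite /A /B [in LHS]invfM.
Qed.

End Kernel.

(** * Columns and multiplicities of a partition *)

Lemma leq_head_partition la x : is_partition la -> x \in la -> (x <= head 0 la)%N.
Proof.
case: la => //= y s /andP[/= ys _]; rewrite inE => /predU1P[->//|xs].
have geq_trans : transitive geq by move=> u v w uv vw; exact: leq_trans uv.
by have /allP/(_ _ xs) := order_path_min geq_trans ys.
Qed.

Lemma part_col1 la : is_partition la -> part_col la 1 = size la.
Proof.
move=> /andP[_ la0]; rewrite /part_col; apply/eqP; rewrite -all_count.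
by apply/allP => x xla; rewrite lt0n; apply: contraNneq la0 => <-.
Qed.

(** Makes each multiplicity a difference of consecutive columns, the a - b of a transition. *)
Lemma part_colS la i : part_col la i = (part_mult la i + part_col la i.+1)%N.
Proof.
rewrite /part_col /part_mult; elim: la => //= x s ->.
by case: (ltngtP i x) => /=; lia.
Qed.

Lemma part_col_geq la i : is_partition la -> (head 0 la < i)%N ->
  part_col la i = 0%N.
Proof.
move=> hla hi; apply/eqP; rewrite /part_col -leqn0 leqNgt -has_count.
apply/hasPn => x xla; rewrite -ltnNge.
exact: leq_ltn_trans (leq_head_partition hla xla) hi.
Qed.

(** Counts the cells of the diagram: a row of length x adds one cell to each of the first x
    columns. *)
Lemma sum_part_col la m : (forall x, x \in la -> (x <= m)%N) ->
  (\sum_(1 <= i < m.+1) part_col la i = sumn la)%N.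
Proof.
elim: la => [|x s IH] hm; first by rewrite big1.
rewrite /= -IH => [|y ys]; last by rewrite hm// inE ys orbT.
rewrite /part_col /= big_split /=; congr addn.
have xm : (x <= m)%N by rewrite hm// mem_head.
rewrite (big_cat_nat _ (n := x.+1))//= big_nat (eq_bigr (fun=> 1%N)); last first.
  by move=> i /andP[_]; rewrite ltnS => ->.
rewrite -big_nat sum_nat_const_nat subn1 muln1 big_nat big1 ?addn0//.
by move=> i /andP[xi _]; rewrite leqNgt xi.
Qed.

(** * Weight of the path of a given partition *)

Section ChainWeight.
Variables (R : realType) (p : R).
Hypothesis hp : 1 < p.

Lemma prod_Ksym (a : nat -> nat) m : (forall i, a i.+1 <= a i)%N ->
  \prod_(0 <= i < m) Ksym p (a i) (a i.+1) =
  qpoch p (a 0%N) / qpoch p (a m) /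
  (p ^+ (\sum_(0 <= i < m) 'C((a i.+1).+1, 2)) *
   \prod_(0 <= i < m) qpoch_even p (a i - a i.+1)./2).
Proof.
move=> ha; elim: m => [|m IH].
  by rewrite !big_geq// expr0 mulr1 divr1 mulfV// gt_eqF// qpoch_gt0.
rewrite !(big_nat_recr m)//= IH KsymE// exprD.
have := lt0r_neq0 (qpoch_gt0 hp (a m)).
rewrite !invfM.
move: (qpoch p (a m)) => x x0.
(* Telescoping: (q)_(a_m) is a denominator in the induction hypothesis and a numerator in the new
   transition. *)
rewrite [LHS](_ : _ = (x / x) * (qpoch p (a 0%N) / qpoch p (a m.+1) /
   (p ^+ (\sum_(0 <= i < m) 'C((a i.+1).+1, 2)) * p ^+ 'C((a m.+1).+1, 2) *
   (\prod_(0 <= i < m) qpoch_even p (a i - a i.+1)./2 *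
    qpoch_even p (a m - a m.+1)./2)))); first by rewrite mulfV// mul1r !invfM.
by rewrite !invfM; ring.
Qed.

(** Index 0 holds the initial state, whereas [part_col la 0] would be [size la]. *)
Definition chain_cols (n : nat) (la : seq nat) (i : nat) : nat :=
  if i is 0 then n else part_col la i.

Lemma chain_cols_nonincreasing n la i : is_partition la -> (size la <= n)%N ->
  (chain_cols n la i.+1 <= chain_cols n la i)%N.
Proof.
move=> hla hn; case: i => [|i] /=; first by rewrite part_col1.
by rewrite [leqRHS]part_colS leq_addl.
Qed.

(** The path has reached 0 after [head 0 la] + 1 steps. The first step has difference n - r, the
    following ones have differences m_i. *)
Lemma prod_Ksym_chain_cols n la : is_partition la -> (size la <= n)%N ->
  \prod_(0 <= i < (head 0%N la).+1)
     Ksym p (chain_cols n la i) (chain_cols n la i.+1) = Psym p n la.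
Proof.
move=> hla hn; set k := head 0%N la.
rewrite prod_Ksym => [|i]; last exact: chain_cols_nonincreasing.
have -> : chain_cols n la k.+1 = 0%N by rewrite /= part_col_geq.
rewrite qpoch0 divr1.
have -> : (\sum_(0 <= i < k.+1) 'C((chain_cols n la i.+1).+1, 2) =
           part_n la + sumn la)%N.
  (* The last column is empty and contributes nothing; elsewhere C(c+1, 2) = C(c, 2) + c separates
     n(la) from |la|. *)
  rewrite big_nat_recr//= part_col_geq// [X in (_ + X)%N]bin_small// addn0.
  rewrite -(@sum_part_col _ k) => [|x]; last exact: leq_head_partition.
  rewrite /part_n -/k -big_split /= [in RHS]big_add1 /=.
  by apply: eq_bigr => i _; rewrite binS bin1.
rewrite big_nat_recl// /Psym -/k.
have -> : \prod_(0 <= i < k)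
    qpoch_even p (chain_cols n la i.+1 - chain_cols n la i.+2)./2 =
  \prod_(1 <= i < k.+1)
     \prod_(1 <= j < ((part_mult la i)./2).+1) (1 - 1 / p ^+ (2 * j)).
  rewrite big_add1 /=; apply: eq_bigr => i _.
  by rewrite [part_col la i.+1]part_colS addnK.
have -> : chain_cols n la 1 = size la by rewrite /= part_col1.
rewrite [chain_cols n la 0]/=.
have -> : qpoch p n = qpoch p (n - size la) *
    \prod_((n - size la).+1 <= j < n.+1) (1 - 1 / p ^+ j).
  by rewrite /qpoch -big_cat_nat//= ltnS leq_subr.
(* The even part of (q)_(n-r) is exactly the denominator left by the step from n to r. *)
rewrite qpoch_parity_split -/(qpoch_odd p (uphalf (n - size la))).
have := lt0r_neq0 (qpoch_even_gt0 hp (n - size la)./2).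
move: (qpoch_even p _) => x x0; rewrite !invfM.
rewrite [LHS](_ : _ = (x / x) *
  (\prod_((n - size la).+1 <= j < n.+1) (1 - 1 / p ^+ j) *
   qpoch_odd p (uphalf (n - size la)) *
   ((p ^+ (part_n la + sumn la))^-1 *
    (\prod_(1 <= i < k.+1)
     \prod_(1 <= j < ((part_mult la i)./2).+1) (1 - 1 / p ^+ (2 * j)))^-1))).
  by rewrite mulfV// mul1r.
ring.
Qed.

End ChainWeight.

(** * Partitions from column sequences, by conjugation *)

Lemma exists_partition_columns (x : nat -> nat) :
  (forall i, x i.+1 <= x i)%N -> (exists l, x l = 0%N) ->
  exists la, [/\ is_partition la, (size la <= x 0)%N & has_columns la x].
Proof.
move=> xS [l xl0].
have xle i j : (i <= j)%N -> (x j <= x i)%N.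
  move=> /subnK <-; elim: (j - i)%N => // m IH.
  by rewrite addSn (leq_trans (xS _)).
(* Row j, counted from 0, ends at the last column longer than j; its length L is the least m with
   x_(m+1) <= j. *)
have rowP j : exists L, forall i, (0 < i)%N -> (i <= L)%N = (j < x i)%N.
  have exL : exists m, (x m.+1 <= j)%N.
    by exists l; rewrite (leq_trans (xS _))// xl0.
  have minL := ex_minnP exL; move: minL => [L hL minL].
  exists L => -[//|i] _; apply/idP/idP.
    by apply: contraTT; rewrite -!leqNgt; exact: minL.
  apply: contraTT; rewrite -!leqNgt => Li.
  by apply: leq_trans hL; exact: xle.
have [f fP] := choice rowP.
(* The rows j < x_1 are the nonempty ones. *)
exists (map f (iota 0 (x 1))); split.
- rewrite /is_partition; apply/andP; split.
    rewrite sorted_map; apply: (sub_sorted _ (iota_sorted 0 (x 1))) => i j ij /=.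
    case: (posnP (f j)) => [->//|fj]; rewrite fP//.
    by rewrite (leq_ltn_trans ij)// -fP.
  apply/negP => /mapP[j]; rewrite mem_iota add0n => /andP[_ jx] f0.
  by move: jx; rewrite -fP// -f0.
- by rewrite size_map size_iota xS.
move=> i i0; rewrite /part_col count_map.
rewrite (@eq_count _ _ (fun j => j < x i)%N) => [|j /=]; last by rewrite fP.
have /subnKC <- : (x i <= x 1)%N by exact: xle.
rewrite iotaD count_cat (@eq_in_count _ _ predT); last first.
  by move=> j; rewrite mem_iota => /andP[].
rewrite count_predT size_iota (@eq_in_count _ _ pred0) ?count_pred0 ?addn0//.
by move=> j; rewrite mem_iota add0n => /andP[xij _]; rewrite ltnNge xij.
Qed.

(** * Path probabilities of a Markov chain *)

Section MarkovPaths.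
Variables (d : measure_display) (T : measurableType d) (R : realType).
Variables (P : probability T R) (X : nat -> {RV P >-> nat}).

Definition cyl (a : nat -> nat) (l : nat) : set T :=
  [set w | forall i, (i <= l)%N -> X i w = a i].

Lemma measurable_eq_RV i k : measurable [set w | X i w = k].
Proof.
rewrite (_ : [set w | _] = X i @^-1` [set k])//.
rewrite -[_ @^-1` _]setTI; exact: measurable_funP.
Qed.

Lemma cyl_bigcap a l : cyl a l =
  \bigcap_(i in [set i | (i <= l)%N]) [set w | X i w = a i].
Proof. by []. Qed.

Lemma measurable_cyl a l : measurable (cyl a l).
Proof.
by rewrite cyl_bigcap; apply: bigcap_measurable => [|i _];
  [exists 0%N|exact: measurable_eq_RV].
Qed.

Lemma cyl_decreasing a l m : (l <= m)%N -> cyl a m `<=` cyl a l.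
Proof. by move=> lm w h i il; apply: h; exact: leq_trans lm. Qed.

Lemma path_bigcap a : [set w | forall i, X i w = a i] = \bigcap_l cyl a l.
Proof.
apply/seteqP; split => w h; first by move=> l _ i _; exact: h.
by move=> i; exact: (h i I i).
Qed.

Lemma measurable_path a : measurable [set w | forall i, X i w = a i].
Proof.
by rewrite path_bigcap; apply: bigcapT_measurable => l; exact: measurable_cyl.
Qed.

(** Continuity from above along the decreasing cylinders. *)
Lemma cvg_cyl_path a :
  P (cyl a l) @[l --> \oo] --> P [set w | forall i, X i w = a i].
Proof.
rewrite path_bigcap; apply: nonincreasing_cvg_mu.
- by rewrite (le_lt_trans (probability_le1 _ (measurable_cyl a 0)))// ltry.
- by move=> i; exact: measurable_cyl.
- by rewrite -path_bigcap; exact: measurable_path.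
- by move=> l m lm; apply/subsetPset; exact: cyl_decreasing.
Qed.

Variables (K : nat -> nat -> R) (n : nat).
Hypothesis markovX : markov_chain_from K n X.

Lemma prob_initial_neq : P [set w | X 0%N w <> n] = 0%E.
Proof.
rewrite (_ : [set w | _] = ~` [set w | X 0%N w = n])//.
rewrite probability_setC; last exact: measurable_eq_RV.
by rewrite markovX.1 subee.
Qed.

Lemma cyl0 a : cyl a 0 = [set w | X 0%N w = a 0%N].
Proof.
apply/seteqP; split => w; first by move=> h; exact: h.
by move=> h i; rewrite leqn0 => /eqP ->.
Qed.

Lemma prob_cyl_add a l m : P (cyl a (l + m)) =
  (P (cyl a l) * (\prod_(l <= i < l + m) K (a i) (a i.+1))%:E)%E.
Proof.
elim: m => [|m IH]; first by rewrite addn0 big_geq// mule1.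
rewrite addnS [LHS](markovX.2 (l + m)%N a) -/(cyl a (l + m)) IH -muleA -EFinM.
by rewrite big_nat_recr// leq_addr.
Qed.

Lemma prob_cyl a l : a 0%N = n ->
  P (cyl a l) = (\prod_(0 <= i < l) K (a i) (a i.+1))%:E.
Proof.
by move=> a0; rewrite -[l in LHS]add0n prob_cyl_add cyl0 a0 markovX.1 mul1e.
Qed.

(** From time l on every transition has probability 1, so the cylinder probabilities are
    constant. *)
Lemma prob_path a l : a 0%N = n ->
  (forall i, (l <= i)%N -> K (a i) (a i.+1) = 1) ->
  P [set w | forall i, X i w = a i] =
  (\prod_(0 <= i < l) K (a i) (a i.+1))%:E.
Proof.
move=> a0 aK; apply/esym/(cvg_unique _ _ (@cvg_cyl_path a)) => //.
apply: cvg_near_cst; exists l => //= m lm.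
rewrite -(subnKC lm) prob_cyl_add prob_cyl// -[RHS]mule1; congr (_ * _%:E)%E.
by rewrite big_nat big1// => i /andP[/aK].
Qed.

(** The events differ only where X_0 <> n; adjoining this null set to both makes them equal. *)
Lemma prob_path_after a : a 0%N = n ->
  P [set w | forall i, (1 <= i)%N -> X i w = a i] =
  P [set w | forall i, X i w = a i].
Proof.
move=> a0; set E := [set w | forall i, X i w = _]; set F := [set w | _].
have mn : measurable [set w | X 0%N w <> n].
  rewrite (_ : [set w | _] = ~` [set w | X 0%N w = n])//.
  by apply: measurableC; exact: measurable_eq_RV.
have mE : measurable E by exact: measurable_path.
have mF : measurable F.
  rewrite (_ : F = \bigcap_(i in [set i | (1 <= i)%N]) [set w | X i w = a i])//.
  by apply: bigcap_measurable => [|i _]; [exists 1%N|exact: measurable_eq_RV].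
rewrite -(measureU0 mE mn prob_initial_neq) -(measureU0 mF mn prob_initial_neq).
congr (P _); apply/seteqP; split => w [h|]; try by right.
- have [h0|] := eqVneq (X 0%N w) n; last by move/eqP; right.
  by left => -[|i]; [rewrite h0|exact: h].
- by left => i _; exact: h.
Qed.

(* Finite histories are countable, so those of probability zero are jointly
   avoided by almost every path. *)
Lemma ae_steps_neq0 :
  {ae P, forall w, X 0%N w = n /\ forall i, K (X i w) (X i.+1 w) != 0}.
Proof.
(* The second set does not depend on [w]: it is everything for a null history and empty
   otherwise. *)
pose F k : set T := if unpickle k is Some s then
    cyl (nth 0%N s) (size s).-1 `&`
      [set w | P (cyl (nth 0%N s) (size s).-1) = 0%E]
  else set0.
have negF k : P.-negligible (F k).
  rewrite /F; case: unpickle => [s|];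
      last exact: negligible_set0.
  have [Ps0|Ps0] := pselect (P (cyl (nth 0%N s) (size s).-1) = 0%E).
    apply: (@negligibleS _ _ _ _ (cyl (nth 0%N s) (size s).-1)) => [w []//|].
    by apply/negligibleP => //; exact: measurable_cyl.
  by apply: (@negligibleS _ _ _ _ set0) => [w [_ /Ps0]|];
      last exact: negligible_set0.
have := negligibleU (negligible_bigcup negF)
  (proj2 (negligibleP P (measurableC (measurable_eq_RV 0 n))) prob_initial_neq).
apply: negligibleS => w /= bad.
have [X0|] := pselect (X 0%N w = n); last by right.
left; apply: contrapT => notF; apply: bad; split=> // i; apply/eqP => Ki0.
(* The history X_0, ..., X_(i+1) ends with the forbidden transition, hence is null. *)
apply: notF; exists (pickle (mkseq (fun j => X j w) i.+2)) => //.
rewrite /F pickleK size_mkseq /=.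
have cylE : cyl (nth 0%N (mkseq (fun j => X j w) i.+2)) i.+1 =
    cyl (fun j => X j w) i.+1.
  by apply/seteqP; split => v h j ji; rewrite h// nth_mkseq.
rewrite cylE; split; first by [].
by rewrite -addn1 prob_cyl_add addn1 big_nat1 Ki0 mule0.
Qed.

(** Eventually constant paths are coded by finite lists, so there are countably many; each with
    final value c in [C] is null because K(c, c)^m tends to 0. *)
Lemma ae_not_eventually_constant (C : set nat) :
  (forall c, C c -> 0 <= K c c < 1) ->
  {ae P, forall w, forall c l, C c -> ~ forall i, (l <= i)%N -> X i w = c}.
Proof.
move=> KC.
(* The default value of [nth] repeats the last entry of [s] forever. *)
pose path s : set T := [set w | forall i, X i w = nth (last 0%N s) s i].
pose F k : set T := if unpickle k is Some s
  then path s `&` [set w | C (last 0%N s)]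
  else set0.
have negF k : P.-negligible (F k).
  rewrite /F; case: unpickle => [s|];
      last exact: negligible_set0.
  have [Cs|Cs] := pselect (C (last 0%N s)); last first.
    by apply: (@negligibleS _ _ _ _ set0) => [w [_ /Cs]|];
      last exact: negligible_set0.
  apply: (@negligibleS _ _ _ _ (path s)) => [w []//|].
  apply/negligibleP; first exact: measurable_path.
  have /andP[K0 K1] := KC _ Cs.
  set c := last 0%N s in Cs K0 K1 *; pose a := nth c s.
  (* Beyond index [size s] all transitions go from c to c, which gives a geometric sequence in m. *)
  have aP : P (cyl a (m + size s)) @[m --> \oo] --> P (path s).
    exact: cvg_comp (cvg_addnr (size s)) (@cvg_cyl_path a).
  apply: (cvg_unique _ aP) => //.
  have -> : (fun m => P (cyl a (m + size s))) =
      (fun m => (fine (P (cyl a (size s))) * K c c ^+ m)%:E).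
    apply/funext => m; rewrite addnC prob_cyl_add EFinM fineK; last first.
      exact: fin_num_measure (measurable_cyl _ _).
    congr (_ * _%:E)%E; rewrite big_nat (eq_bigr (fun=> K c c)); last first.
      by move=> i /andP[si _]; rewrite /a !nth_default// leqW.
    by rewrite -big_nat prodr_const_nat addKn.
  by apply: cvg_EFin; [exact: nearW|apply: cvg_geometric; rewrite ger0_norm].
apply: negligibleS (negligible_bigcup negF) => w /= /existsNP[c /existsNP[l]].
move=> /not_implyP[Cc /contrapT Xc].
exists (pickle (mkseq (fun j => X j w) l.+1)) => //; rewrite /F pickleK.
have lastE : last 0%N (mkseq (fun j => X j w) l.+1) = c.
  rewrite (last_nth 0%N) size_mkseq /=.
  by rewrite -[nth _ _ _]/(nth 0%N (mkseq _ l.+1) l) nth_mkseq// Xc.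
rewrite /path lastE; split => //= i.
have [il|li] := ltnP i l.+1; first by rewrite nth_mkseq.
by rewrite nth_default ?size_mkseq// Xc// ltnW.
Qed.

End MarkovPaths.

(** * Absorption at 0 and the law of the partition *)

Lemma nonincreasing_nat_eventually_constant (x : nat -> nat) :
  (forall i, x i.+1 <= x i)%N ->
  exists l, forall i, (l <= i)%N -> x i = x l.
Proof.
move=> xS.
have ex : exists c, `[< exists l, x l = c >].
  by exists (x 0%N); apply/asboolP; exists 0%N.
have [c /asboolP[l xl] cmin] := ex_minnP ex.
exists l => i li; apply/eqP; rewrite eqn_leq; apply/andP; split.
  by rewrite -(subnK li); elim: (i - l)%N => // m; exact: leq_trans (xS _).
by rewrite xl; apply: cmin; apply/asboolP; exists i.
Qed.

Theorem theorem4p1 (R : realType) (p : R) (hp : 1 < p) (n : nat)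
    (hn : (0 < n)%N) :
  stochastic_kernel (Ksym p) /\
  forall (d : measure_display) (T : measurableType d) (P : probability T R)
         (X : nat -> {RV P >-> nat}),
    markov_chain_from (Ksym p) n X ->
    {ae P, forall w, exists la : seq nat,
        [/\ is_partition la, (size la <= n)%N & has_columns la (X ^~ w)]} /\
    forall la : seq nat, is_partition la -> (size la <= n)%N ->
      P [set w | has_columns la (X ^~ w)] = (Psym p n la)%:E.

Proof.
split; first exact: Ksym_stochastic.
move=> d T P X markovX; split.
  have KC c : [set c | (0 < c)%N] c -> 0 <= Ksym p c c < 1.
    move=> /= c0; rewrite Ksym_ge0//= Ksym_diag//.
    rewrite invf_lt1 ?exprn_gt0 ?(lt_trans ltr01)//.
    by rewrite exprn_egt1// -lt0n bin_gt0.
  apply: filterS2 (ae_steps_neq0 markovX) (ae_not_eventually_constant markovX KC).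
  move=> w [X0 KX] notconst.
  have XS i : (X i.+1 w <= X i w)%N.
    by apply: contraNT (KX i); rewrite /Ksym => /negPf ->.
  rewrite -X0; apply: (@exists_partition_columns (X ^~ w)) => //.
  have [l Xl] := nonincreasing_nat_eventually_constant XS.
  (* A positive eventual value is almost surely excluded. *)
  exists l; case: (posnP (X l w)) => // Xl0.
  by case: (notconst _ l Xl0).
move=> la hla lan.
rewrite (_ : [set w | _] =
    [set w | forall i, (1 <= i)%N -> X i w = chain_cols n la i]); last first.
  by apply/seteqP; split => w h [//|i] i0; exact: h.
rewrite (prob_path_after markovX)//.
(* From this time on the path stays at 0, where K(0, 0) = 1. *)
rewrite (prob_path markovX (l := (head 0%N la).+1))// ?prod_Ksym_chain_cols//.
move=> [//|i] ki /=; rewrite !part_col_geq//; last exact: ltnW.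
by rewrite Ksym_diag// bin_small// expr0 invr1.
Qed.
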